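(* Every $\overline{h}$-perfect graph $G$ is $\binom{\omega(G)+1}{2}$-colourable, where $\omega(G)$ is the maximum size of a clique of $G$.
   Context: All graphs are finite and simple. For a graph $G=(V,E)$, $\mathrm{STAB}(G)\subseteq\mathbb{R}^V$ is the convex hull of incidence vectors of stable sets of $G$; $\mathrm{HSTAB}(G)$ is the set of $x\in\mathbb{R}^V$ with $x_v\ge 0$ for every vertex $v$, $\sum_{v\in K}x_v\le1$ for every clique $K$, and $\sum_{v\in V(C)}x_v\le\frac{|V(C)|-1}{2}$ for every odd cycle $C$ of $G$. $G$ is h-perfect if $\mathrm{STAB}(G)=\mathrm{HSTAB}(G)$. A graph is $\overline{h}$-perfect if its complement is h-perfect. A graph is $k$-colourable if its vertex set is a union of $k$ stable sets. *)

(* Defs.v *)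
From HB Require Import structures.
From mathcomp Require Import all_boot all_order all_algebra.
From mathcomp Require Import classical_sets reals convex.

Set Implicit Arguments.
Unset Strict Implicit.
Unset Printing Implicit Defensive.

Import Order.TTheory GRing.Theory Num.Theory.

Local Open Scope ring_scope.

Record sgraph := SGraph {
  vertex : finType;
  adj : rel vertex;
  adj_sym : symmetric adj;
  adj_irr : irreflexive adj
}.

Section Complement.
Variable G : sgraph.

Definition compl_adj : rel (vertex G) := fun u v => (u != v) && ~~ adj u v.

Lemma compl_adj_sym : symmetric compl_adj.
Proof. by move=> u v; rewrite /compl_adj eq_sym adj_sym. Qed.

Lemma compl_adj_irr : irreflexive compl_adj.
Proof. by move=> u; rewrite /compl_adj eqxx. Qed.

Definition compl_graph : sgraph := SGraph compl_adj_sym compl_adj_irr.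

End Complement.

Section GraphParameters.
Variable G : sgraph.

Definition stable (S : {set vertex G}) : bool :=
  [forall u in S, forall v in S, ~~ adj u v].

Definition clique (K : {set vertex G}) : bool :=
  [forall u in K, forall v in K, (u != v) ==> adj u v].

Definition omega : nat := \max_(K : {set vertex G} | clique K) #|K|.

Definition colourable (k : nat) : Prop :=
  exists S : 'I_k -> {set vertex G},
    (forall i, stable (S i)) /\ \bigcup_(i < k) S i = [set: vertex G].

(* [c] lists the vertices of a cycle subgraph (chords allowed) in cyclic
   order; [ucycle] alone also accepts the empty list and a repeated edge. *)
Definition odd_cycle (c : seq (vertex G)) : Prop :=
  [/\ ucycle (@adj G) c, (2 < size c)%N & odd (size c)].

End GraphParameters.

Section Polytopes.
Variable R : realType.

Definition convex_hull (E : lmodType R) (A : set E) : set E :=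
  smallest (@convex_set R E) A.

Variable G : sgraph.

(* R^V; the regular module [R^o] is what makes this an [lmodType R]. *)
Notation RV := {ffun vertex G -> R^o}.

Definition incidence (S : {set vertex G}) : RV := [ffun v => (v \in S)%:R].

Definition STAB : set RV :=
  convex_hull [set x | exists2 S, stable S & x = incidence S]%classic.

Definition HSTAB : set RV :=
  [set x : RV |
    [/\ forall v, 0 <= x v :> R,
        forall K, clique K -> \sum_(v in K) x v <= 1 :> R
      & forall c, odd_cycle c ->
          \sum_(v <- c) x v <= (size c - 1)%:R / 2 :> R]]%classic.

Definition h_perfect : Prop := STAB = HSTAB.

End Polytopes.

Definition hbar_perfect (R : realType) (G : sgraph) : Prop :=
  h_perfect R (compl_graph G).

(* Main.v *)
Require Import Defs.
From mathcomp Require Import boolp classical_sets interval_inference.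
From mathcomp Require Import all_boot reals.
From mathcomp Require Import all_order all_algebra zify lra.

(** Let [H] be the complement of [G], so that colourings of [G] are clique
    covers of [H] and [omega G] is the stability number of [H].  For a set [U]
    of vertices, let [x] be the average of the incidence vectors of the maximum
    stable subsets of [U].  If no clique or odd cycle inequality were tight at
    [x], a slightly larger multiple of [x] would lie in [HSTAB = STAB], although
    its sum over [U] exceeds the stability number [a] of [U].  If a clique is
    tight, then every maximum stable subset of [U] meets it.  If an odd cycle
    of length [2k+1 > 3] is tight, then every maximum stable subset of [U] has
    [k >= 2] vertices on it, hence meets the cycle minus a vertex, which is
    covered by [k <= a] edges.  In each case, deleting at most [a] cliques
    lowers the stability number of [U], and [a + (a-1) + ... + 1] is the
    binomial coefficient. *)

Set Implicit Arguments.
Unset Strict Implicit.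
Unset Printing Implicit Defensive.

Import Order.TTheory GRing.Theory Num.Theory.

Local Open Scope ring_scope.

(** * Stability numbers and clique covers *)

Section StabilityNumber.
Variable H : sgraph.
Implicit Types (U W S K : {set vertex H}) (n : nat).

Definition alpha U : nat :=
  \max_(S : {set vertex H} | stable S && (S \subset U)) #|S|.

Definition clique_cover n W : Prop :=
  exists L : seq {set vertex H},
    [/\ all (@clique H) L, (size L <= n)%N & W \subset \bigcup_(K <- L) K].

Lemma stable0 : stable (set0 : {set vertex H}).
Proof. by apply/forall_inP => u; rewrite inE. Qed.

Lemma leq_alpha U S : stable S -> S \subset U -> (#|S| <= alpha U)%N.
Proof. by move=> sS sU; apply: leq_bigmax_cond; rewrite sS. Qed.

Lemma alpha_witness U :
  exists S, [/\ stable S, S \subset U & #|S| = alpha U].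
Proof.
have /(eq_bigmax_cond (fun S : {set _} => #|S|)) [S] :
    (0 < #|[pred S : {set vertex H} | stable S && (S \subset U)]|)%N.
  by apply/card_gt0P; exists set0; rewrite inE stable0 sub0set.
by rewrite inE => /andP[sS sU] eS; exists S; split=> //; rewrite -eS.
Qed.

Lemma alpha_eq0 U : alpha U = 0%N -> U = set0.
Proof.
move=> aU; apply/eqP; apply/set0Pn => -[v vU].
have : (#|[set v]| <= alpha U)%N.
  apply: leq_alpha; last by rewrite sub1set.
  apply/forall_inP => u /set1P ->; apply/forall_inP => w /set1P ->.
  by rewrite adj_irr.
by rewrite cards1 aU.
Qed.

Lemma clique_cover_weaken m n W :
  (m <= n)%N -> clique_cover m W -> clique_cover n W.
Proof.
by move=> le_mn [L [cL sL WL]]; exists L; split=> //; apply: leq_trans le_mn.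
Qed.

Lemma clique_coverU m n U W :
  clique_cover m U -> clique_cover n W -> clique_cover (m + n) (U :|: W).
Proof.
move=> [L [cL sL UL]] [L' [cL' sL' WL']]; exists (L ++ L').
rewrite all_cat cL cL' size_cat leq_add // big_cat /=; split=> //.
exact: setUSS.
Qed.

Lemma clique_cover1 K : clique K -> clique_cover 1 K.
Proof. by move=> cK; exists [:: K]; rewrite /= cK big_seq1. Qed.

Lemma clique_edge (u v : vertex H) : adj u v -> clique [set u; v].
Proof.
move=> uv; apply/forall_inP => x /set2P[] ->; apply/forall_inP => y /set2P[] ->.
- by rewrite eqxx.
- by rewrite uv implybT.
- by rewrite adj_sym uv implybT.
- by rewrite eqxx.
Qed.

(** Consecutive vertices of [p] are paired into [k] edges. The start [v] stays uncovered: it is the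
    vertex removed from an odd cycle. *)
Lemma clique_cover_path k (v : vertex H) p :
  path (@adj H) v p -> size p = k.*2 -> clique_cover k [set u in p].
Proof.
elim: k v p => [|k IHk] v p.
  by case: p => // _ _; exists [::]; split=> //; apply/subsetP => u; rewrite inE.
case: p => [|a [|b p]] //= /and3P[_ ab bp] [] sp.
have -> : [set u in a :: b :: p] = [set a; b] :|: [set u in p].
  by apply/setP => u; rewrite !inE orbA.
exact: clique_coverU (clique_cover1 (clique_edge ab)) (IHk _ _ bp sp).
Qed.

Lemma clique_triangle (c : seq (vertex H)) :
  odd_cycle c -> size c = 3 -> clique [set u in c].
Proof.
case=> /andP[+ _] _ _; case: c => [|x [|y [|z []]]] //=.
case/and4P=> xy yz zx _ _.
apply/forall_inP => u; rewrite !inE => /or3P[] /eqP ->;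
  apply/forall_inP => w; rewrite !inE => /or3P[] /eqP ->;
  by rewrite ?eqxx // ?xy ?yz ?zx ?implybT // adj_sym ?xy ?yz ?zx implybT.
Qed.

End StabilityNumber.

(** * Polyhedral inequalities, tightness, and covers of h-perfect graphs *)

Section HPerfect.
Variables (R : realType) (H : sgraph).
Implicit Types (U W S K A : {set vertex H}).

Lemma sum_incidence S A :
  \sum_(v in A) @incidence R H S v = #|S :&: A|%:R :> R.
Proof.
rewrite -sum1_card natr_sum big_mkcond [RHS]big_mkcond /=.
by apply: eq_bigr => v _; rewrite ffunE inE; case: (v \in A); case: (v \in S).
Qed.

Lemma incidence_STAB S : stable S -> @STAB R H (@incidence R H S).
Proof. by move=> sS; apply: sub_gen_smallest; exists S. Qed.

(** The half-space [B] is convex and contains each generator, because [S :&: U] is a stable subset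
    of [U]. *)
Lemma STAB_sum_le x U :
  @STAB R H x -> \sum_(v in U) x v <= (alpha U)%:R :> R.
Proof.
move: x; pose B := [set x : {ffun vertex H -> R^o} |
  \sum_(v in U) x v <= (alpha U)%:R :> R]%classic.
suff : (@STAB R H `<=` B)%classic by [].
apply: smallest_sub => [x y t|_ [S sS ->]].
  rewrite !in_setE /B /= => xB yB.
  under eq_bigr do rewrite !ffunE.
  rewrite big_split /= -!scaler_sumr.
  have t0 : 0 <= t%:num :> R by [].
  have t1 : t%:num <= 1 :> R by [].
  rewrite /GRing.scale /= /unstable.onem.
  move: (\sum_(v in U) x v) (\sum_(v in U) y v) xB yB => a b xB yB.
  nra.
rewrite /B /= sum_incidence ler_nat leq_alpha ?subsetIr //.
apply/forall_inP => u /setIP[uS _]; apply/forall_inP => v /setIP[vS _].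
by move/forall_inP/(_ _ uS)/forall_inP/(_ _ vS): sS.
Qed.

Lemma sum_odd_cycle (c : seq (vertex H)) (x : {ffun vertex H -> R^o}) :
  odd_cycle c -> \sum_(v <- c) x v = \sum_(v in [set u in c]) x v :> R.
Proof.
case=> /andP[_ uc] _ _; rewrite big_uniq //=.
by apply: eq_bigl => v; rewrite inE.
Qed.

Lemma odd_cycle_rhs (c : seq (vertex H)) :
  odd_cycle c -> (size c - 1)%:R / 2 = (size c)./2%:R :> R.
Proof.
case=> _ _ oc; rewrite -{1}[size c]odd_double_half oc add1n subn1 /=.
by rewrite -muln2 natrM mulfK // pnatr_eq0.
Qed.

Hypothesis hH : h_perfect R H.

Lemma stable_clique_card S K : stable S -> clique K -> (#|S :&: K| <= 1)%N.
Proof.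
move=> /incidence_STAB; rewrite hH => -[_ hK _] /hK.
by rewrite sum_incidence (ler_nat R _ 1).
Qed.

Lemma stable_odd_cycle_card S (c : seq (vertex H)) :
  stable S -> odd_cycle c -> (#|S :&: [set u in c]| <= (size c)./2)%N.
Proof.
move=> /incidence_STAB; rewrite hH => -[_ _ hC] oc; move: (hC _ oc).
by rewrite odd_cycle_rhs // sum_odd_cycle // sum_incidence ler_nat.
Qed.

(* [slack A b] says that the inequality [x(A) <= b] is valid for, and not tight
   on, the incidence vectors of the members of [M]. *)
Let slack (M : {set {set vertex H}}) A b :=
  [/\ forall S, S \in M -> (#|S :&: A| <= b)%N,
      exists2 S, S \in M & (#|S :&: A| < b)%N
    & (b <= #|vertex H|)%N].

(** One member of [M] falls short of [b] by at least 1, so the total falls short of [#|M| * b]. *)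
Lemma slack_sum M A b :
  slack M A b -> (\sum_(S in M) #|S :&: A| < #|M| * b)%N.
Proof.
case=> le_b [S0 S0M lt_b] _; rewrite -sum_nat_const.
rewrite (bigD1 S0) //= [ltnRHS](bigD1 S0) //= -addSn leq_add //.
by apply: leq_sum => S /andP[/le_b].
Qed.

(* The incidence vectors of [M] are averaged and scaled up by
   [n (d + 1) / (n (d + 1) - 1) > 1], for [n = #|M|] and [d = #|V|]; integrality
   gives each slack inequality enough room for it. *)
Lemma no_slack U (M : {set {set vertex H}}) :
  (0 < alpha U)%N ->
  (forall S, S \in M -> [/\ stable S, S \subset U & #|S| = alpha U]) ->
  (0 < #|M|)%N ->
  (forall K, clique K -> slack M K 1) ->
  (forall c, odd_cycle c -> slack M [set u in c] (size c)./2) ->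
  False.
Proof.
move=> aU_gt0 MP n_gt0 slackK slackC.
set n := #|M| in n_gt0; set d := #|vertex H|.
have d_gt0 : (0 < d)%N.
  apply: leq_trans aU_gt0 _; have [S [_ _ <-]] := alpha_witness U.
  exact: max_card.
have nd_gt1 : (1 < n * d.+1)%N by nia.
pose t : R := d.+1%:R / (n * d.+1).-1%:R.
have den_gt0 : 0 < (n * d.+1).-1%:R :> R by rewrite ltr0n; lia.
have t_ge0 : 0 <= t by rewrite divr_ge0.
pose y : {ffun vertex H -> R^o} :=
  [ffun v => t * \sum_(S in M) @incidence R H S v].
have sum_y A : \sum_(v in A) y v = t * (\sum_(S in M) #|S :&: A|)%:R :> R.
  under [LHS]eq_bigr do rewrite ffunE.
  rewrite -mulr_sumr exchange_big natr_sum /=; congr (_ * _).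
  by apply: eq_bigr => S _; apply: sum_incidence.
have slack_y A b : slack M A b -> \sum_(v in A) y v <= b%:R :> R.
  move=> sl; have := slack_sum sl; case: sl => _ _ le_bd lt_sum.
  rewrite sum_y /t mulrAC ler_pdivrMr // -!natrM ler_nat.
  (* Since [T <= n * b - 1], the goal [d.+1 * T <= b * (n * d.+1 - 1)] follows from [b <= d.+1]. *)
  move: lt_sum le_bd nd_gt1; rewrite -/n -/d.
  move: (\sum_(S in M) _)%N => T; nia.
have : @STAB R H y.
  rewrite hH; split.
  - move=> v; rewrite ffunE mulr_ge0 ?sumr_ge0 // => S _.
    by rewrite ffunE ler0n.
  - by move=> K /slackK/slack_y.
  - move=> c oc; rewrite odd_cycle_rhs // sum_odd_cycle //.
    exact/slack_y/slackC.
move/(STAB_sum_le U); rewrite sum_y.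
have -> : (\sum_(S in M) #|S :&: U| = n * alpha U)%N.
  rewrite -sum_nat_const; apply: eq_bigr => S /MP[_ SU <-].
  by rewrite (setIidPl SU).
(* With [a = alpha U], this would give [d.+1 * (n * a) <= a * (n * d.+1 - 1)], impossible for
   [a > 0]. *)
rewrite /t mulrAC ler_pdivrMr // -!natrM ler_nat.
move: nd_gt1 aU_gt0; move: (alpha U) => a; nia.
Qed.

Lemma hitting_cliques U : (0 < alpha U)%N ->
  exists2 W, clique_cover (alpha U) W & (alpha (U :\: W) < alpha U)%N.
Proof.
move=> aU_gt0; apply: contrapT => noW.
pose M := [set S : {set vertex H} |
  [&& stable S, S \subset U & #|S| == alpha U]].
have MP S : S \in M -> [/\ stable S, S \subset U & #|S| = alpha U].
  by rewrite inE => /and3P[? ? /eqP].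
(* By [noW], deleting [W] does not lower the stability number, so some maximum stable subset of [U]
   avoids [W]. *)
have escape W : clique_cover (alpha U) W ->
    exists2 S, S \in M & S :&: W = set0.
  move=> cW; have [S [sS SUW aS]] := alpha_witness (U :\: W).
  move: SUW; rewrite subsetD => /andP[SU /disjoint_setI0 SW].
  exists S => //; rewrite inE sS SU eqn_leq leq_alpha // aS leqNgt /=.
  by apply/negP => lt_a; apply: noW; exists W.
have slack_clique K : clique K -> slack M K 1.
  move=> cK; split.
  - by move=> S /MP[sS _ _]; apply: stable_clique_card.
  - have [|S SM SK] := escape K; last by exists S => //; rewrite SK cards0.
    exact: clique_cover_weaken (clique_cover1 cK).
  - have [S [_ _ aS]] := alpha_witness U.
    by apply: leq_trans (max_card S); rewrite aS.
apply: (no_slack aU_gt0 MP _ slack_clique).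
  apply/card_gt0P; have [S [sS SU aS]] := alpha_witness U.
  by exists S; rewrite inE sS SU aS eqxx.
(* A triangle is treated as a clique: for [k = 1], avoiding all but one vertex of the cycle would
   not give a strict inequality. *)
move=> c oc; have [c3|c_neq3] := eqVneq (size c) 3.
  by rewrite c3; apply/slack_clique/clique_triangle.
split.
- by move=> S /MP[sS _ _]; apply: stable_odd_cycle_card.
- case: c c_neq3 oc => [|v p] c_neq3 oc; first by case: oc.
  have [/andP[pathc _] /= sz_gt2 sz_odd] := oc.
  set k := (size (v :: p))./2.
  have szp : size p = k.*2.
    by have := odd_double_half (size (v :: p)); rewrite /= sz_odd => -[<-].
  have k_gt1 : (1 < k)%N by move: c_neq3; rewrite /= szp; lia.
  (* If [alpha U < k], any member of [M] is too small to be tight; otherwise the [k] edges covering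
     [p] are few enough for [escape]. *)
  have [le_ka|lt_ak] := leqP k (alpha U); last first.
    have [S [sS SU aS]] := alpha_witness U.
    exists S; first by rewrite inE sS SU aS eqxx.
    by apply: leq_ltn_trans lt_ak; rewrite -aS subset_leq_card // subsetIl.
  have [|S SM Sp0] := escape [set u in p].
    apply: clique_cover_weaken le_ka _; apply: (@clique_cover_path _ _ v) => //.
    by move: pathc; rewrite /= rcons_path => /andP[].
  (* As [S] avoids [p], it can meet the cycle only in [v]. *)
  exists S => //; apply: leq_ltn_trans k_gt1.
  rewrite -(cards1 v) subset_leq_card //; apply/subsetP => u.
  rewrite !inE => /andP[uS /orP[//|up]].
  by move/setP/(_ u): Sp0; rewrite !inE uS up.
- apply: (@leq_trans (size c)); first by lia.
  by have [/andP[_ /card_uniqP <-] _ _] := oc; apply: max_card.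
Qed.

(** Induction on [alpha U]: with [a = alpha U], Pascal's rule splits the bound into ['C(a, 2)]
    cliques for [U :\: W] and [a] for [W]. *)
Lemma clique_cover_bin U : clique_cover 'C((alpha U).+1, 2) U.
Proof.
have [m] := ubnP (alpha U); elim: m U => // m IHm U lt_am.
have [/alpha_eq0 ->|aU_gt0] := posnP (alpha U).
  by exists [::]; split=> //; apply: sub0set.
have [W cW lt_aW] := hitting_cliques aU_gt0.
have cUW : clique_cover 'C(alpha U, 2) (U :\: W).
  apply: clique_cover_weaken (IHm _ _); last by lia.
  exact: leq_bin2l.
have [L [cL sL WL]] := clique_coverU cUW cW.
exists L; split=> //; first by rewrite binS bin1.
apply: subset_trans WL; apply/subsetP => v vU.
by rewrite !inE vU andbT orNb.
Qed.

End HPerfect.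

(** * Passing to the complement *)

Lemma stable_compl (G : sgraph) (S : {set vertex G}) :
  stable (G := compl_graph G) S = clique S.
Proof.
apply: eq_forallb_in => u _; apply: eq_forallb_in => v _.
by rewrite /= /compl_adj negb_and negbK implybE !negbK.
Qed.

Lemma clique_compl_stable (G : sgraph) (S : {set vertex G}) :
  clique (G := compl_graph G) S -> stable S.
Proof.
move=> cS; apply/forall_inP => u uS; apply/forall_inP => v vS.
move/forall_inP/(_ _ uS)/forall_inP/(_ _ vS): cS.
rewrite /= /compl_adj; case: eqVneq => [->|_ //].
by rewrite adj_irr.
Qed.

Lemma alpha_compl (G : sgraph) :
  alpha [set: vertex (compl_graph G)] = omega G.
Proof. by apply: eq_bigl => S; rewrite stable_compl subsetT andbT. Qed.

Theorem theorem6p2 (R : realType) (G : sgraph) (hG : hbar_perfect R G) :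
  colourable G 'C((omega G).+1, 2).
Proof.
have [L [cL sL]] := clique_cover_bin hG [set: vertex (compl_graph G)].
rewrite alpha_compl in sL; move/subsetP => VL.
(* [L] may be shorter than the number of colours; the surplus colours get the stable set [set0]. *)
exists (fun i => nth set0 L i); split.
  move=> i; have [lt_iL|le_Li] := ltnP i (size L).
    by apply: clique_compl_stable; apply: (all_nthP _ cL).
  by rewrite nth_default // stable0.
apply/setP => v; rewrite !inE; apply/bigcupP.
have := VL v (in_setT v); rewrite (big_nth set0) big_mkord => /bigcupP[i _ vi].
by exists (widen_ord sL i).
Qed.
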